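(* There exist a finite simple graph $G$ with exactly $14$ vertices and list chromatic number equal to $3$, and a $2$-list assignment $L$ of $G$, such that at most $9$ vertices of $G$ can be properly coloured from $L$; that is, for every set $S\subseteq V(G)$ and every function $f:S\to\bigcup_{v\in V(G)}L(v)$ satisfying $f(v)\in L(v)$ for all $v\in S$ and $f(u)\neq f(v)$ for every edge $uv$ of $G$ with $u,v\in S$, we have $|S|\leq 9$.
   Context: Graphs are finite, simple and undirected. For a positive integer $k$, a $k$-list assignment of a graph $G$ is a function $L$ assigning to each vertex $v\in V(G)$ a set $L(v)$ of exactly $k$ colours (colours may be taken to be natural numbers). A proper $L$-colouring of $G$ is a function $f$ on $V(G)$ with $f(v)\in L(v)$ for every $v\in V(G)$ and $f(u)\neq f(v)$ for every edge $uv\in E(G)$. The list chromatic number of $G$ is the least positive integer $k$ such that for every $k$-list assignment $L$ of $G$ there exists a proper $L$-colouring of $G$. A set $S\subseteq V(G)$ of vertices can be properly coloured from $L$ if the induced subgraph $G[S]$ has a proper colouring in which each vertex $v\in S$ receives a colour from $L(v)$. *)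

(* Defs.v *)
From mathcomp Require Import all_boot.
From mathcomp Require Import finmap.

Set Implicit Arguments.
Unset Strict Implicit.
Unset Printing Implicit Defensive.

Record sgraph := SGraph {
  vertex :> finType;
  adj : rel vertex;
  adj_sym : symmetric adj;
  adj_irrefl : irreflexive adj
}.

Definition list_assignment (G : sgraph) : Type := G -> {fset nat}.

Definition is_k_list_assignment (G : sgraph) (k : nat) (L : list_assignment G) : Prop :=
  forall v : G, #|` L v| = k.

(* A colouring of S is represented by a total function on the vertices whose
   values outside S are ignored. *)
Definition proper_colouring_on (G : sgraph) (L : list_assignment G)
    (S : {set G}) (f : G -> nat) : Prop :=
  (forall v : G, v \in S -> f v \in L v) /\
  (forall u v : G, u \in S -> v \in S -> adj u v -> f u <> f v).

Definition proper_colouring (G : sgraph) (L : list_assignment G)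
    (f : G -> nat) : Prop :=
  (forall v : G, f v \in L v) /\
  (forall u v : G, adj u v -> f u <> f v).

Definition choosable (G : sgraph) (k : nat) : Prop :=
  forall L : list_assignment G, is_k_list_assignment k L ->
    exists f : G -> nat, proper_colouring L f.

Definition is_list_chromatic_number (G : sgraph) (k : nat) : Prop :=
  [/\ 0 < k, choosable G k & forall j : nat, 0 < j -> choosable G j -> k <= j].

(* Main.v *)
Require Import Defs.
From mathcomp Require Import all_boot.
From mathcomp Require Import finmap.
From mathcomp Require Import zify.

(** Two non-adjacent hubs [x], [y] have lists {0,1} and {2,3}; for each choice
    of [a] in {0,1} and [b] in {2,3} there is a triangle all of whose lists are
    {a,b}, two of its vertices being joined to both hubs. Every triangle misses
    a vertex, since its lists contain only two colours. If [x] gets [a] and [y]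
    gets [b], the triangle {a,b} has two vertices without available colour;
    otherwise a hub is uncoloured. In both cases five vertices are missed.

    For lists of size 3, it suffices to colour the hubs so that every triangle
    keeps two available colours at its first vertex, whose list is [M]. If the
    hubs share a colour, give it to both. Otherwise there are nine pairs of hub
    colours, and each [M] contains at most two of them, because [M] meets the
    disjoint hub lists in at most three elements altogether; the four triangles
    exclude at most eight pairs. *)

Section Fsets.
Variable K : choiceType.
Implicit Types A B M : {fset K}.

Lemma fset_pick A B : #|` B| < #|` A| -> exists2 c, c \in A & c \notin B.
Proof.
move=> ltBA; have /fset0Pn[c] : (A `\` B)%fset != fset0.
  by rewrite fsetD_eq0; apply: contraL ltBA; rewrite -leqNgt; apply: fsubset_leq_card.
by rewrite in_fsetD => /andP[cB cA]; exists c.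
Qed.

(** Either hypothesis forces [M] to meet [[fset a; b]] in at most one element. The disjunct [a == b]
    serves the case of a colour shared by both hubs. *)
Lemma cardfsD2_gt1 a b M : #|` M| = 3 ->
  ~~ ((a \in M) && (b \in M)) || (a == b) -> 1 < #|` M `\` [fset a; b]|%fset.
Proof.
move=> M3 abM; suff: #|` M `&` [fset a; b]|%fset <= 1 by rewrite cardfsD; lia.
case/orP: abM => [abM | /eqP->]; last first.
  have := fsubset_leq_card (fsubsetIr M [fset b; b]%fset).
  by rewrite cardfs2 eqxx.
have [aM | aM] := boolP (a \in M).
  rewrite aM /= in abM; rewrite -(cardfs1 a); apply/fsubset_leq_card/fsubsetP=> c.
  by rewrite !inE => /andP[cM /orP[//|/eqP cb]]; rewrite -cb cM in abM.
rewrite -(cardfs1 b); apply/fsubset_leq_card/fsubsetP=> c.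
by rewrite !inE => /andP[cM /orP[/eqP ca|//]]; rewrite -ca cM in aM.
Qed.

Lemma disjoint_pairs_avoid A B (Ms : seq {fset K}) :
    [disjoint A & B]%fset -> #|` A| = 3 -> #|` B| = 3 ->
    (forall M, M \in Ms -> #|` M| = 3) -> size Ms < 5 ->
  exists a b, [/\ a \in A, b \in B
    & forall M, M \in Ms -> ~~ ((a \in M) && (b \in M))].
Proof.
move=> dAB A3 B3 Ms3 ltMs.
pose s := [seq (a, b) | a <- A, b <- B].
pose bad := flatten [seq [seq (a, b) | a <- (A `&` M)%fset, b <- (B `&` M)%fset]
                    | M : {fset K} <- Ms].
have s9 : size s = 9 by rewrite size_allpairs A3 B3.
have us : uniq s by apply: allpairs_uniq => // -[? ?] [? ?].
have sbad : size bad <= 2 * size Ms.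
  rewrite {}/bad; move: Ms3; elim: {ltMs} Ms => //= M Ms IH Ms3.
  have M3 : #|` M| = 3 by apply: Ms3; rewrite mem_head.
  have {}IH := IH (fun N NMs => Ms3 N (mem_behead (s := M :: Ms) NMs)).
  rewrite size_cat size_allpairs mulnS; apply: leq_add => //.
  (* The two intersections are disjoint parts of [M], so their sizes satisfy [m + n <= 3], whence
     [m * n <= 2]. *)
  have dI : ((A `&` M) `&` (B `&` M) = fset0)%fset.
    by rewrite fsetIACA (eqP dAB) fset0I.
  have := cardfsUI (A `&` M)%fset (B `&` M)%fset.
  rewrite dI cardfs0 addn0 -fsetIUl => eqI.
  have := fsubset_leq_card (fsubsetIr (A `|` B)%fset M).
  rewrite M3 eqI; move: #|` A `&` M|%fset #|` B `&` M|%fset => m n.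
  by case: m n => [|[|[|[|m]]]] [|[|[|[|n]]]].
have /allPn[[a b] /allpairsP[[a' b'] /= [aA bB [-> ->]]] nbad] :
    ~~ all (mem bad) s.
  apply/negP=> /allP/(uniq_leq_size us); rewrite s9 => /leq_trans/(_ sbad); lia.
exists a', b'; split=> // M MMs; apply: contra nbad => /andP[aM bM].
apply/flattenP; exists [seq (a, b) | a <- (A `&` M)%fset, b <- (B `&` M)%fset].
  by apply/mapP; exists M.
by apply: allpairs_f; rewrite inE ?aA ?bB.
Qed.

Lemma hub_colours A B (Ms : seq {fset K}) :
    #|` A| = 3 -> #|` B| = 3 ->
    (forall M, M \in Ms -> #|` M| = 3) -> size Ms < 5 ->
  exists a b, [/\ a \in A, b \in B
    & forall M, M \in Ms -> 1 < #|` M `\` [fset a; b]|%fset].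
Proof.
move=> A3 B3 Ms3 ltMs; have [dAB | ] := boolP [disjoint A & B]%fset.
  have [a [b [aA bB abMs]]] := disjoint_pairs_avoid _ _ _ dAB A3 B3 Ms3 ltMs.
  by exists a, b; split=> // M MMs; apply: cardfsD2_gt1; rewrite ?Ms3 ?abMs.
case/fset0Pn=> c; rewrite inE => /andP[cA cB].
by exists c, c; split=> // M MMs; apply: cardfsD2_gt1; rewrite ?Ms3 ?eqxx ?orbT.
Qed.

(** Greedy choice in the order [c1], [c0], [c2], with [H] the set of hub colours. The last vertex is
    not joined to the hubs, so [c2] may lie in [H] and only has to avoid [c0] and [c1]. *)
Lemma triangle_colours (H M0 M1 M2 : {fset K}) :
    #|` H| <= 2 -> 1 < #|` M0 `\` H|%fset -> #|` M1| = 3 -> #|` M2| = 3 ->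
  exists c : 'I_3 -> K,
    [/\ c ord0 \in M0, c (inord 1) \in M1, c ord_max \in M2,
        c ord0 \notin H & c (inord 1) \notin H] /\ injective c.
Proof.
move=> H2 M0H M1_3 M2_3.
have [c1 c1M c1H] : exists2 c, c \in M1 & c \notin H by apply: fset_pick; lia.
have [c0 c0M c01] : exists2 c, c \in (M0 `\` H)%fset & c \notin [fset c1]%fset.
  by apply: fset_pick; rewrite cardfs1.
have [c2 c2M c2n] : exists2 c, c \in M2 & c \notin [fset c0; c1]%fset.
  by apply: fset_pick; rewrite cardfs2 M2_3; case: (_ != _).
move: c0M c01 c2n; rewrite !inE => /andP[c0H c0M] c01 /norP[c20 c21].
(* The default [c2] of [nth] is the colour at index 2. *)
exists (fun i : 'I_3 => nth c2 [:: c0; c1] i); split.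
  by rewrite inordK.
have u : uniq [:: c0; c1; c2].
  by rewrite /= !inE negb_or c01 (eq_sym c0) c20 (eq_sym c1) c21.
move=> i j; rewrite -!(nth_rcons_default c2 [:: c0; c1]) /= => eqc.
by apply/val_inj/eqP; rewrite -(nth_uniq c2 _ _ u) ?ltn_ord //; apply/eqP.
Qed.

End Fsets.

(* [inl false] and [inl true] are the hubs; [inr ((s, t), i)] is the [i]-th
   vertex of the triangle whose lists are the [s]-th colour of the first hub
   and the [t]-th colour of the second; [i = 2] is not joined to the hubs. *)
Definition hub_vertex : finType := (bool + (bool * bool) * 'I_3)%type.

Definition hub_adj (u v : hub_vertex) : bool :=
  match u, v with
  | inl _, inl _ => false
  | inl _, inr (_, i) | inr (_, i), inl _ => i < 2
  | inr (p, i), inr (q, j) => (p == q) && (i != j)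
  end.

Lemma hub_adj_sym : symmetric hub_adj.
Proof. by case=> [?|[p i]] [?|[q j]] //=; rewrite eq_sym (eq_sym i). Qed.

Lemma hub_adj_irrefl : irreflexive hub_adj.
Proof. by case=> [?|[p i]] //=; rewrite !eqxx. Qed.

Definition hub_graph : sgraph := SGraph hub_adj_sym hub_adj_irrefl.

Definition hub_colour (z s : bool) : nat := z.*2 + s.

Definition hub_list : list_assignment hub_graph := fun v : hub_vertex =>
  match v with
  | inl z => [fset hub_colour z false; hub_colour z true]%fset
  | inr ((s, t), _) => [fset hub_colour false s; hub_colour true t]%fset
  end.

Lemma card_hub_graph : #|hub_graph| = 14.
Proof. by rewrite card_sum !card_prod card_bool card_ord. Qed.

Lemma hub_list_2 : is_k_list_assignment 2 hub_list.
Proof. by case=> [[]|[[[] []] i]]; rewrite cardfs2. Qed.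

Lemma hub_graph_3_choosable : choosable hub_graph 3.
Proof.
move=> L L3.
pose M p : {fset nat} := L (inr (p, ord0)).
have [a [b [aA bB abM]]] : exists a b, [/\ a \in L (inl false), b \in L (inl true)
    & forall N, N \in map M (enum predT) -> 1 < #|` N `\` [fset a; b]|%fset].
  apply: hub_colours; rewrite ?L3 //; last first.
    by rewrite size_map -cardE card_prod card_bool.
  by move=> N /mapP[p _ ->]; apply: L3.
have tri p : exists c : 'I_3 -> nat,
    (forall i, c i \in L (inr (p, i))) /\
    (forall i : 'I_3, i < 2 -> c i \notin [fset a; b]%fset) /\ injective c.
  have [|||| c [[c0 c1 c2 c0H c1H] cI]] := @triangle_colours _ [fset a; b]%fset
    (M p) (L (inr (p, inord 1))) (L (inr (p, ord_max))); rewrite ?L3 //.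
  - by rewrite cardfs2; case: (_ != _).
  - by apply: abM; rewrite map_f // mem_enum.
  have i1 : inord 1 = Ordinal (isT : 1 < 3) by apply/val_inj; rewrite /= inordK.
  rewrite i1 in c1 c1H.
  exists c; split; last split=> //.
    case=> -[|[|[|//]]] lt; rewrite (bool_irrelevance lt isT) //.
    - by rewrite (_ : Ordinal _ = ord0) //; apply: val_inj.
    - by rewrite (_ : Ordinal _ = ord_max) //; apply: val_inj.
  case=> -[|[|//]] lt _; rewrite (bool_irrelevance lt isT) //.
  by rewrite (_ : Ordinal _ = ord0) //; apply: val_inj.
have [c cP] := fin_all_exists tri.
pose f (v : hub_vertex) := match v with
  | inl z => if z then b else a
  | inr (p, i) => c p i
  end.
exists f; split=> [[[]|[p i]]|] //=; first by have [] := cP p.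
have hub z p (i : 'I_3) : i < 2 -> f (inl z) <> f (inr (p, i)).
  have [_ [cH _]] := cP p; move/cH; rewrite !inE => /norP[/eqP ca /eqP cb].
  by case: z => /= /esym.
case=> [z|[p i]] [z'|[q j]] //=.
- exact: hub.
- by move=> lt /esym; apply: hub.
- by case/andP=> /eqP<- /eqP ij; have [_ [_ cI]] := cP p; move/cI.
Qed.

Lemma hub_list_bound (S : {set hub_graph}) (f : hub_graph -> nat) :
  proper_colouring_on hub_list S f -> #|S| <= 9.
Proof.
case=> fL fE.
pose n (s t : bool) := \sum_(i < 3) ((inr ((s, t), i) : hub_graph) \in S : nat).
have cardS : #|S| = ((inl true : hub_graph) \in S) + ((inl false : hub_graph) \in S)
    + (n true true + n true false + (n false true + n false false)).
  rewrite -sum1_card big_mkcond big_sumType /= big_bool.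
  rewrite (eq_bigr (fun v : (bool * bool) * 'I_3 =>
    ((inr (v.1, v.2) : hub_graph) \in S : nat))) => [|[p i] _]; last by case: ifP.
  rewrite -(pair_bigA _ (fun p i => ((inr (p, i) : hub_graph) \in S : nat))) /=.
  rewrite (eq_bigr (fun p => n p.1 p.2)) => [|[] //].
  rewrite -(pair_bigA _ n) /= !big_bool.
  by do 2!case: (_ \in S).
have fT s t i : (inr ((s, t), i) : hub_graph) \in S ->
    f (inr ((s, t), i)) = hub_colour false s \/ f (inr ((s, t), i)) = hub_colour true t.
  by move/fL; rewrite /= !inE => /orP[]/eqP; [left|right].
have fTE p i j : i != j -> (inr (p, i) : hub_graph) \in S ->
    (inr (p, j) : hub_graph) \in S -> f (inr (p, i)) <> f (inr (p, j)).
  by move=> ij iS jS; apply: fE => //=; rewrite eqxx.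
(* Pigeonhole: three pairwise adjacent vertices would share two colours. *)
have n2 s t : n s t <= 2.
  rewrite /n !big_ord_recl big_ord0.
  case i0 : (_ \in S); case i1 : (_ \in S); case i2 : (_ \in S) => //.
  have := fTE _ _ _ _ i0 i1; have := fTE _ _ _ _ i0 i2; have := fTE _ _ _ _ i1 i2.
  case: (fT _ _ _ i0) => ->; case: (fT _ _ _ i1) => ->; case: (fT _ _ _ i2) => ->;
    move=> h12 h02 h01; try by [case: h12|case: h02|case: h01].
have n1 s t : (inl false : hub_graph) \in S -> (inl true : hub_graph) \in S ->
    f (inl false) = hub_colour false s -> f (inl true) = hub_colour true t ->
    n s t <= 1.
  move=> xS yS fx fy.
  (* Both colours of such a vertex are already taken by the adjacent hubs. *)
  have dead (i : 'I_3) : i < 2 -> ((inr ((s, t), i) : hub_graph) \in S) = false.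
    move=> lti; apply/negP=> iS; case: (fT _ _ _ iS) => fi.
      by apply: (fE _ _ xS iS) => //; rewrite fx fi.
    by apply: (fE _ _ yS iS) => //; rewrite fy fi.
  by rewrite /n !big_ord_recl big_ord0 (dead ord0) // (dead (lift ord0 ord0)) //; case: (_ \in S).
rewrite cardS; clearbody n.
have tt2 := n2 true true; have tf2 := n2 true false.
have ft2 := n2 false true; have ff2 := n2 false false.
(* With a hub missing, the count is at most 1 + 4 * 2; with both present, it is at most 2 + 1 + 3 *
   2. *)
case yS : (_ \in S); case xS : (_ \in S); try lia.
have := fL _ yS; have := fL _ xS; rewrite /= !inE.
by case/orP=> /eqP fx /orP[]/eqP fy; have := n1 _ _ xS yS fx fy; lia.
Qed.

Theorem theorem1p1 :
  exists (G : sgraph) (L : list_assignment G),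
    [/\ #|G| = 14,
        is_list_chromatic_number G 3,
        is_k_list_assignment 2 L
      & forall (S : {set G}) (f : G -> nat),
          proper_colouring_on L S f -> #|S| <= 9].
Proof.
exists hub_graph, hub_list; split.
- exact: card_hub_graph.
- split=> // [|[|[|[|j]]]] //; first exact: hub_graph_3_choosable.
  (* One colour fails on any edge when all lists are equal. *)
  + move=> _ /(_ (fun=> [fset 0]%fset)) [v|f [fL fE]]; first by rewrite cardfs1.
    have f0 v : f v = 0 by apply/eqP; have := fL v; rewrite inE.
    by case: (fE (inl true) (inr ((true, true), ord0))); rewrite ?f0.
  (* A full colouring from [hub_list] would give 14 <= 9. *)
  + move=> _ /(_ hub_list hub_list_2) [f [fL fE]].
    have := @hub_list_bound [set: hub_graph] f.
    by rewrite cardsT card_hub_graph; apply; split=> *; [apply: fL | apply: fE].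
- exact: hub_list_2.
- exact: hub_list_bound.
Qed.
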